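(* Suppose $\mathrm{P}_1=\dots=\mathrm{P}_q=\overline{\mathrm{P}}$, where $\overline{\mathrm{P}}$ follows the uniform distribution on $[0,1]$. Then the unconditional expected score of $\Theta_0$, denoted $E_{\overline{\mathcal U}}(\Theta_0)$ in this case, is given by $$E_{\overline{\mathcal U}}(\Theta_0)=\frac1{q+1}\sum_{b\in\{0,1\}^q}\frac{1}{\binom{q}{\sum_cb_c}}\,\theta_0^b=\frac1{q+1}\sum_{i=0}^q\Bigg(\sum_{\substack{b\in\{0,1\}^q\\ \sum_cb_c=i}}\frac1{\binom{q}{i}}\,\theta_0^b\Bigg).$$
   Context: Setting: $n$ decision making units (DMUs) are described by nonnegative input and output data $x_{ij}$, $y_{rj}$. The (CCR) DEA efficiency score of $DMU_0$ is the optimal value of the linear program: minimize $\theta_0$ subject to $\sum_{j=1}^n\lambda_jx_{ij}\le\theta_0x_{i0}$ for every included input $i$, $\sum_{j=1}^n\lambda_jy_{rj}\ge y_{r0}$ for every included output $r$, and $\lambda_j\ge0$ for all $j$. There are $q\ge1$ candidate variables $z_1,\dots,z_q$, each an input or an output. For $b=(b_1,\dots,b_q)\in\{0,1\}^q$, $\theta_0^b$ is the (real) score of $DMU_0$ when exactly the candidates $z_c$ with $b_c=1$ are included; by convention $\theta_0^{(0,\dots,0)}=1$. $\Theta_0$ is the random score that takes the value $\theta_0^b$ in scenario $b$; $\{\Theta_0=\theta_0^b\}$ denotes the scenario $b$ (scenarios are counted separately even if scores coincide). Given $\overline{\mathrm{P}}=\overline{\mathrm{p}}\in[0,1]$, all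 candidates are included independently, each with the same probability $\overline{\mathrm{p}}$, so $P(\Theta_0=\theta_0^b\mid\overline{\mathrm{P}}=\overline{\mathrm{p}})=\prod_{c=1}^q\overline{\mathrm{p}}^{\,b_c}(1-\overline{\mathrm{p}})^{1-b_c}$ (with $0^0=1$). The unconditional probability function of $\Theta_0$ is the expected conditional probability, $P(\Theta_0=\theta_0^b)=E[P(\Theta_0=\theta_0^b\mid\overline{\mathrm{P}})]$, and the unconditional expected efficiency score is defined by $\sum_{b\in\{0,1\}^q}\theta_0^b\,P(\Theta_0=\theta_0^b)$. *)

(* Defs.v *)
From HB Require Import structures.
From mathcomp Require Import all_boot all_order all_algebra.
From mathcomp Require Import all_classical all_reals all_analysis.

Set Implicit Arguments.
Unset Strict Implicit.
Unset Printing Implicit Defensive.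

Import Order.TTheory GRing.Theory Num.Theory.
Import numFieldNormedType.Exports.

Local Open Scope classical_set_scope.
Local Open Scope ring_scope.

(* b c = true when candidate c is included. *)
Definition scenario (q : nat) := {ffun 'I_q -> bool}.

Definition no_candidate (q : nat) : scenario q := [ffun=> false].

Definition nincluded (q : nat) (b : scenario q) : nat := (\sum_(c < q) b c)%N.

Section DEA.
Variables (R : realType) (q n : nat).

(* z c j is the value of candidate c for unit j: it is an input datum x_cj when
   is_input c, and an output datum y_cj otherwise. *)
Variables (is_input : 'I_q -> bool) (z : 'I_q -> 'I_n -> R).

Definition dea_constraints (o : 'I_n) (b : scenario q)
    (theta : R) (lambda : 'I_n -> R) : Prop :=
  [/\ forall c, b c -> is_input c ->
        \sum_(j < n) lambda j * z c j <= theta * z c o,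
      forall c, b c -> ~~ is_input c ->
        z c o <= \sum_(j < n) lambda j * z c j
    & forall j, 0 <= lambda j].

Definition dea_feasible (o : 'I_n) (b : scenario q) (theta : R) : Prop :=
  exists lambda : 'I_n -> R, dea_constraints o b theta lambda.

Definition dea_optimal_value (o : 'I_n) (b : scenario q) (v : R) : Prop :=
  dea_feasible o b v /\ forall theta, dea_feasible o b theta -> v <= theta.

(* For nonnegative data the program is always feasible, and it has an optimal
   value unless z c o = 0 for every included input c (in particular, when no
   input is included); it is then unbounded below. In such a scenario the score
   is the real number degenerate_score b, an arbitrary convention. *)
Definition dea_score (degenerate_score : scenario q -> R) (o : 'I_n)
    (b : scenario q) : R :=
  if b == no_candidate q then 1
  else xget (degenerate_score b) [set v | dea_optimal_value o b v].

End DEA.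

(* p ^+ 0 = 1 for every p, so 0^0 = 1. *)
Definition cond_scenario_prob (R : realType) (q : nat) (p : R)
    (b : scenario q) : R :=
  \prod_(c < q) (p ^+ b c * (1 - p) ^+ (1 - b c)).

Section Unconditional.
Context d (T : measurableType d) (R : realType) (P : probability T R).
Variables (q : nat) (Pbar : {RV P >-> R}).

Definition scenario_prob (b : scenario q) : \bar R :=
  'E_P[(fun w => cond_scenario_prob (Pbar w) b)].

Definition expected_score (score : scenario q -> R) : \bar R :=
  (\sum_(b : scenario q) (score b)%:E * scenario_prob b)%E.

End Unconditional.

(* Main.v *)
Require Import Defs.
From HB Require Import structures.
From mathcomp Require Import all_boot all_order all_algebra.
From mathcomp Require Import all_classical all_reals all_analysis.
From mathcomp Require Import measurable_realfun.

Import Order.TTheory GRing.Theory Num.Theory.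
Import numFieldNormedType.Exports.

Local Open Scope classical_set_scope.
Local Open Scope ring_scope.

(** Given [Pbar = p], a scenario [b] that includes [k] of the [q] candidates has
    probability [p ^ k * (1 - p) ^ (q - k)]: only the number of included
    candidates matters ([cond_scenario_probE]).  Averaging over a uniform [p]
    gives Euler's beta integral [k! (q - k)! / (q + 1)!], which is
    [1 / ((q + 1) * binomial q k)] ([uniform_scenario_prob]); in other words the
    number of included candidates is uniform on [{0, ..., q}] and, given that
    number, all scenarios are equally likely.  Multiplying by the scores and
    summing over the scenarios gives the first formula; grouping the scenarios by
    their number of included candidates gives the second.

    The analytic point is that [Pbar] lies in [[0, 1]] only almost surely.
    Outside this interval the polynomial [p ^ k * (1 - p) ^ (q - k)] may be
    negative, so it is first replaced by its restriction to the interval, to which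
    the change of variables for nonnegative functions applies
    ([expectation_uniform]). *)

Lemma uniform_prob_itvC (R : realType) (a b : R) (ab : a < b) :
  uniform_prob ab (~` `[a, b]) = 0%E.
Proof.
by rewrite /uniform_prob integral_uniform_pdf setICl integral_set0.
Qed.

Section ExpectationUniform.
Context d (T : measurableType d) (R : realType) (P : probability T R).
Variables (a b : R) (ab : a < b) (X : {RV P >-> R}).
Hypothesis X_uniform : forall A : set R, measurable A ->
  distribution P X A = uniform_prob ab A.

Lemma uniform_ae_itv : {ae P, forall w, X w \in `[a, b]}.
Proof.
have mC : measurable (~` `[a, b] : set R) by exact: measurableC.
exists (X @^-1` (~` `[a, b])); split.
- by rewrite -[X in measurable X]setTI; exact: measurable_funPT.
- by rewrite -(uniform_prob_itvC R a b ab) -X_uniform.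
- by move=> w /=.
Qed.

(** [f] and its restriction [g] to [[a, b]] agree almost surely along [X], and
    [g] is nonnegative everywhere, so its integral can be transported from [P] to
    the law of [X].  The sign of [f] is controlled only on [[a, b]] so that the
    lemma covers polynomials such as [x * (1 - x)] on [[0, 1]]. *)
Lemma expectation_uniform (f : R -> R) : measurable_fun setT f ->
    (forall x, x \in `[a, b] -> 0 <= f x) ->
  ('E_P[f \o X] =
    (b - a)^-1%:E * \int[lebesgue_measure]_(x in `[a, b]) (f x)%:E)%E.
Proof.
move=> mf f0; pose g := f \_ `[a, b].
have mg : measurable_fun setT g.
  by apply/(measurable_restrict _ _ _) => //; exact: measurable_funTS.
have g0 x : 0 <= g x by rewrite /g patchE; case: ifPn => // /set_mem /f0.
rewrite unlock (ae_eq_integral (fun w => (g (X w))%:E)) //; last 3 first.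
- by apply/measurable_EFinP; exact: measurableT_comp.
- by apply/measurable_EFinP; exact: measurableT_comp.
- apply: filterS uniform_ae_itv => w Xw _.
  by rewrite /g patchE mem_set.
(* The Borel sets of [R] carry two displays: random variables use the default
   one, Lebesgue measure and [integral_uniform] the one of [measurableTypeR].
   The sets themselves are convertible, so [X] is measurable for both, and
   transporting along [X] directly into [measurableTypeR R] avoids comparing
   measures with different displays. *)
have mX : @measurable_fun _ _ T (measurableTypeR R) setT X.
  exact: (measurable_funPT X).
have mgE : @measurable_fun _ _ (measurableTypeR R) (\bar R) setT (EFin \o g).
  exact: (measurableT_comp (f := EFin)).
have := @ge0_integral_pushforward _ _ _ _ _ _ mX P setT (EFin \o g).
rewrite preimage_setT => <- //; last by move=> x _; rewrite lee_fin.
rewrite (eq_measure_integral (uniform_prob ab)) => [|A mA _]; last first.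
  exact: X_uniform.
rewrite integral_uniform //.
congr (_ * _)%E; apply: eq_integral => x xab.
by rewrite /= /g patchE xab.
Qed.

End ExpectationUniform.

Lemma integral_XMonemX_fact (R : realType) (k l : nat) :
  (\int[lebesgue_measure]_(x in `[0%R, 1%R]) (XMonemX k l x)%:E)%E
    = ((k`! * l`!)%:R / (k + l).+1`!%:R : R)%:E.
Proof.
rewrite -beta_fun_fact EFin_beta_fun /=.
by rewrite (integral_XMonemX_restrict setT k l) setTI.
Qed.

Lemma fact_ratio_bin (R : numFieldType) (q k : nat) : (k <= q)%N ->
  (k`! * (q - k)`!)%:R / q.+1`!%:R = q.+1%:R^-1 * 'C(q, k)%:R^-1 :> R.
Proof.
move=> kq; rewrite factS -(bin_fact kq) mulnA [in X in _ / X]natrM invfM.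
by rewrite mulrCA divff ?mulr1 ?natrM ?invfM // -natrM pnatr_eq0 -lt0n
  muln_gt0 !fact_gt0.
Qed.

Lemma nincluded_le (q : nat) (b : scenario q) : (nincluded b <= q)%N.
Proof.
rewrite /nincluded -[leqRHS]card_ord -sum1_card.
by apply: leq_sum => c _; exact: leq_b1.
Qed.

(** The exponents collect into [\sum_c b c] and [\sum_c (1 - b c)], the numbers
    of included and of excluded candidates. *)
Lemma cond_scenario_probE (R : realType) (q : nat) (p : R) (b : scenario q) :
  cond_scenario_prob p b = XMonemX (nincluded b) (q - nincluded b) p.
Proof.
have exclE : (q - nincluded b = \sum_(c < q) (1 - b c))%N.
  by rewrite sumnB ?sum1_card ?card_ord // => c _; exact: leq_b1.
by rewrite /cond_scenario_prob /XMonemX big_split /= exclE !prodrXr.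
Qed.

(** The conditional probability is a polynomial in [Pbar], nonnegative on
    [[0, 1]], so its expectation is a beta integral. *)
Lemma uniform_scenario_prob d (T : measurableType d) (R : realType)
    (P : probability T R) (q : nat) (Pbar : {RV P >-> R}) (b : scenario q) :
    (forall A : set R, measurable A ->
       distribution P Pbar A = uniform_prob (@ltr01 R) A) ->
  scenario_prob Pbar b = (q.+1%:R^-1 * 'C(q, nincluded b)%:R^-1)%:E.
Proof.
move=> Pbar_uniform; rewrite /scenario_prob.
under eq_fun do rewrite cond_scenario_probE.
rewrite (expectation_uniform _ _ _ _ _ _ _ _ Pbar_uniform).
- rewrite subr0 invr1 mul1e integral_XMonemX_fact subnKC ?nincluded_le //.
  by rewrite fact_ratio_bin ?nincluded_le.
- exact: measurable_XMonemX.
- by move=> x; exact: XMonemX_ge0.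
Qed.

Theorem corollary4p4 (R : realType) (q n : nat) (q_ge1 : (1 <= q)%N)
    (is_input : 'I_q -> bool) (z : 'I_q -> 'I_n -> R)
    (z_ge0 : forall c j, 0 <= z c j)
    (o : 'I_n) (degenerate_score : scenario q -> R)
    (d : measure_display) (T : measurableType d) (P : probability T R)
    (Pbar : {RV P >-> R})
    (Pbar_uniform : forall A : set R, measurable A ->
       distribution P Pbar A = uniform_prob (@ltr01 R) A) :
  let theta := dea_score is_input z degenerate_score o in
  expected_score Pbar theta
    = ((q.+1%:R)^-1 *
       \sum_(b : scenario q) ('C(q, nincluded b)%:R)^-1 * theta b)%:E
  /\
  (q.+1%:R)^-1 * (\sum_(b : scenario q) ('C(q, nincluded b)%:R)^-1 * theta b)
    = (q.+1%:R)^-1 *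
      \sum_(i < q.+1) \sum_(b : scenario q | nincluded b == i)
         ('C(q, i)%:R)^-1 * theta b.
Proof.
move=> theta; split.
  rewrite /expected_score mulr_sumr -sumEFin; apply: eq_bigr => b _.
  by rewrite uniform_scenario_prob // -EFinM mulrC mulrA.
congr (_ * _).
(* [nincluded b] is at most [q], so [inord] does not truncate it. *)
rewrite (partition_big (fun b => inord (nincluded b) : 'I_q.+1) xpredT) //.
apply: eq_bigr => i _; apply: eq_big => [b|b /eqP <-].
  by rewrite -val_eqE /= inordK // ltnS nincluded_le.
by rewrite inordK // ltnS nincluded_le.
Qed.
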